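(* Let $n\geq 2$ be an integer and let $\mathcal{C}_n=\operatorname{SPC}(n)\otimes\operatorname{SPC}(n)$. The homogeneous weight enumerator of $\mathcal{C}_n$ is symmetric, i.e. $W_{\mathcal{C}_n}(x,y)=W_{\mathcal{C}_n}(y,x)$, if and only if $n$ is even.
   Context: For $n\geq 2$, $\operatorname{SPC}(n)=\{\mathbf{x}\in\mathbb{F}_2^n:\sum_{i=1}^{n}x_i=0\}$ is the binary single parity-check code of length $n$. For binary linear codes $C_1,C_2$ with generator matrices $G_1,G_2$, the product code $C_1\otimes C_2$ is the linear code generated by the Kronecker product $G_1\otimes G_2$. Arranging coordinates row by row, $\mathcal{C}_n=\operatorname{SPC}(n)\otimes\operatorname{SPC}(n)$ is the $\mathbb{F}_2$-linear space of all $n\times n$ matrices over $\mathbb{F}_2$ in which every row and every column has even Hamming weight; its length is $n^2$. For a linear code $\mathcal{C}$ of length $N$, let $A_w$ be the number of codewords of Hamming weight $w$ (number of nonzero entries). The homogeneous weight enumerator is $W_{\mathcal{C}}(x,y)=\sum_{w=0}^{N}A_w x^{N-w}y^w$. *)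

(* Defs.v *)
From HB Require Import structures.
From mathcomp Require Import all_boot all_algebra.
From mathcomp Require Import mxtens.
From mathcomp Require Import mpoly.

Set Implicit Arguments.
Unset Strict Implicit.
Unset Printing Implicit Defensive.

Import GRing.Theory.
Local Open Scope ring_scope.

(* A binary linear code of length N is a subspace C : {vspace 'rV['F_2]_N}. *)

Definition parity (n : nat) (x : 'rV['F_2]_n) : ('F_2)^o := \sum_(i < n) x 0 i.

Fact parity_linear (n : nat) : linear (@parity n).
Proof.
move=> a x y; rewrite /parity scaler_sumr -big_split.
by apply: eq_bigr => i _; rewrite !mxE.
Qed.

HB.instance Definition _ (n : nat) :=
  GRing.isLinear.Build 'F_2 'rV['F_2]_n ('F_2)^o _ (@parity n) (@parity_linear n).

Definition SPC (n : nat) : {vspace 'rV['F_2]_n} := lker (linfun (@parity n)).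

Lemma mem_SPC (n : nat) (x : 'rV['F_2]_n) :
  (x \in SPC n) = (\sum_(i < n) x 0 i == 0).
Proof. by rewrite memv_ker lfunE. Qed.

Definition code_of (k N : nat) (G : 'M['F_2]_(k, N)) : {vspace 'rV['F_2]_N} :=
  <<[seq row i G | i : 'I_k]>>%VS.

Definition gen_mx (N : nat) (C : {vspace 'rV['F_2]_N}) : 'M['F_2]_(\dim C, N) :=
  \matrix_(i < \dim C) (vbasis C)`_i.

(* Coordinates of the Kronecker product are ordered row by row: the index of
   position (i, j) is i * N2 + j.  The choice of generator matrices is
   irrelevant by [prod_codeE] below. *)
Definition prod_code (N1 N2 : nat)
    (C1 : {vspace 'rV['F_2]_N1}) (C2 : {vspace 'rV['F_2]_N2}) :
    {vspace 'rV['F_2]_(N1 * N2)} :=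
  code_of (gen_mx C1 *t gen_mx C2).

Definition hamming_weight (N : nat) (c : 'rV['F_2]_N) : nat :=
  #|[set i : 'I_N | c 0 i != 0]|.

Definition weight_count (N : nat) (C : {vspace 'rV['F_2]_N}) (w : nat) : nat :=
  #|[set c : 'rV['F_2]_N | (c \in C) && (hamming_weight c == w)]|.

(* The variables x and y are 'X_0 and 'X_1. *)
Definition weight_enum (N : nat) (C : {vspace 'rV['F_2]_N}) : {mpoly int[2]} :=
  \sum_(w < N.+1)
    (weight_count C w)%:R * ('X_0 ^+ (N - w) * 'X_1 ^+ w).

Lemma mem_code_of (k N : nat) (G : 'M['F_2]_(k, N)) (v : 'rV['F_2]_N) :
  (v \in code_of G) = (v <= G)%MS.
Proof.
apply/idP/idP => [/coord_span ->|/submxP[u ->]].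
  apply: summx_sub => i _; apply: scalemx_sub.
  have: (image_tuple (fun i => row i G) 'I_k)`_i \in [seq row i G | i : 'I_k].
    by apply: mem_nth; rewrite size_tuple.
  by case/imageP => j _ ->; apply: row_sub.
rewrite mulmx_sum_row; apply: memv_suml => i _; apply: memvZ.
by apply: memv_span; apply: image_f.
Qed.

Lemma code_of_gen_mx (N : nat) (C : {vspace 'rV['F_2]_N}) :
  code_of (gen_mx C) = C.
Proof.
rewrite -[RHS](span_basis (vbasisP C)); apply/eqP.
rewrite eqEsubv; apply/andP; split; apply/span_subvP => v.
  by case/imageP => i _ ->; rewrite rowK memv_span // mem_nth // size_tuple.
case/(nthP 0) => i; rewrite size_tuple => lti <-.
apply: memv_span; apply/imageP; exists (Ordinal lti) => //.
by rewrite rowK.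
Qed.

Lemma prod_codeE (k1 k2 N1 N2 : nat)
    (G1 : 'M['F_2]_(k1, N1)) (G2 : 'M['F_2]_(k2, N2)) :
  prod_code (code_of G1) (code_of G2) = code_of (G1 *t G2).
Proof.
have tensS m1 m2 p1 p2 (A1 : 'M['F_2]_(m1, N1)) (A2 : 'M['F_2]_(m2, N2))
    (B1 : 'M['F_2]_(p1, N1)) (B2 : 'M['F_2]_(p2, N2)) :
    (A1 <= B1)%MS -> (A2 <= B2)%MS -> (A1 *t A2 <= B1 *t B2)%MS.
  by move=> /submxP[D1 ->] /submxP[D2 ->]; rewrite -tensmx_mul submxMl.
have sub m p N (A : 'M['F_2]_(m, N)) (B : 'M['F_2]_(p, N)) :
    code_of A = code_of B -> (A <= B)%MS.
  by move=> e; apply/row_subP => i; rewrite -mem_code_of -e mem_code_of row_sub.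
apply/vspaceP => v; rewrite !mem_code_of.
by apply/idP/idP => /submx_trans; apply;
  apply: tensS; apply: sub; rewrite code_of_gen_mx.
Qed.

(* Main.v *)
(** Adding the all-ones word complements supports, so if it lies in a binary
    code of length N then w |-> N - w preserves the weight distribution;
    conversely symmetry forces A_N = A_0 = 1.  Hence W_C is symmetric iff the
    all-ones word lies in C.  That word is the tensor square of the all-ones
    word of length n, so it lies in the product code when n is even; and every
    word of the product code has entries summing to 0, whereas the n^2 entries
    of the all-ones word sum to n^2. *)

Require Import Defs.
From mathcomp Require Import all_boot all_algebra.
From mathcomp Require Import mxtens.
From mathcomp Require Import mpoly.

Import GRing.Theory.

Local Open Scope ring_scope.

Lemma F2_add1_neq0 (a : 'F_2) : (1 + a != 0) = (a == 0).
Proof. by case: a => [] [|[]]. Qed.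

Lemma natr_F2_eq0 (n : nat) : (n%:R == 0 :> 'F_2) = ~~ odd n.
Proof. by rewrite -(dvdn_pcharf (pchar_Fp (erefl (prime 2)))) dvdn2. Qed.

Lemma hamming_weight_le (N : nat) (c : 'rV['F_2]_N) :
  (hamming_weight c <= N)%N.
Proof. by rewrite -[leqRHS]card_ord max_card. Qed.

Lemma hamming_weight_eq0 (N : nat) (c : 'rV['F_2]_N) :
  (hamming_weight c == 0%N) = (c == 0).
Proof.
rewrite cards_eq0; apply/eqP/eqP => [h|->].
  apply/rowP => i; rewrite mxE; apply/eqP/negPn.
  by move/setP/(_ i): h; rewrite !inE => ->.
by apply/setP => i; rewrite !inE mxE eqxx.
Qed.

Lemma hamming_weightC (N : nat) (c : 'rV['F_2]_N) :
  hamming_weight (const_mx 1 + c) = (N - hamming_weight c)%N.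
Proof.
rewrite /hamming_weight cardsCs card_ord; congr (_ - _)%N; apply: eq_card => i.
by rewrite !inE !mxE F2_add1_neq0.
Qed.

Lemma addKones (N : nat) :
  involutive (+%R (const_mx 1 : 'rV['F_2]_N)).
Proof.
move=> c; apply/rowP => i; rewrite !mxE addrA.
by rewrite (_ : 1 + 1 = 0) ?add0r //; apply/val_inj.
Qed.

(** Complementing turns weight [N] into weight 0, which only the zero word has. *)
Lemma hamming_weight_eqN (N : nat) (c : 'rV['F_2]_N) :
  (hamming_weight c == N) = (c == const_mx 1).
Proof.
rewrite eqn_leq hamming_weight_le /= -subn_eq0 -hamming_weightC.
rewrite hamming_weight_eq0; apply/eqP/eqP => [h|->].
  by rewrite -[c]addKones h addr0.
by rewrite -[X in _ + X]addr0 addKones.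
Qed.

Lemma weight_count0 (N : nat) (C : {vspace 'rV['F_2]_N}) :
  weight_count C 0 = 1%N.
Proof.
rewrite /weight_count (_ : [set _ | _] = [set 0]) ?cards1 //.
apply/setP => c; rewrite !inE hamming_weight_eq0.
by case: eqP => [->|_]; rewrite ?mem0v ?andbF.
Qed.

Lemma weight_countN (N : nat) (C : {vspace 'rV['F_2]_N}) :
  weight_count C N = (const_mx 1 \in C) :> nat.
Proof.
rewrite /weight_count; case: (boolP (const_mx 1 \in C)) => hC.
  rewrite (_ : [set _ | _] = [set const_mx 1]) ?cards1 //.
  apply/setP => c; rewrite !inE hamming_weight_eqN.
  by case: eqP => [->|_]; rewrite ?hC ?andbF.
apply/eqP; rewrite cards_eq0; apply/eqP/setP => c.
rewrite !inE hamming_weight_eqN.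
by case: eqP => [->|_]; rewrite ?(negPf hC) ?andbF.
Qed.

Lemma weight_countC (N : nat) (C : {vspace 'rV['F_2]_N}) (w : nat) :
  const_mx 1 \in C -> (w <= N)%N -> weight_count C (N - w) = weight_count C w.
Proof.
move=> hC lew; rewrite /weight_count -(card_imset _ (can_inj (@addKones N))).
(* Writing [c] as the complement of its complement exposes it as a member of the image. The bounds
   [w <= N] and [hamming_weight c <= N] then make the truncated subtraction from [N] cancellable. *)
apply: eq_card => c; rewrite -[c]addKones (mem_imset _ _ (can_inj (@addKones N))).
by rewrite !inE addKones rpredDl // hamming_weightC eqn_sub2lE ?hamming_weight_le.
Qed.

Lemma weight_enum_swap (N : nat) (C : {vspace 'rV['F_2]_N}) :
  weight_enum C \mPo [tuple 'X_1; 'X_0] =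
  \sum_(w < N.+1)
    (weight_count C w)%:R * ('X_1 ^+ (N - w) * 'X_0 ^+ w) :> {mpoly int[2]}.
Proof.
rewrite /weight_enum rmorph_sum; apply: eq_bigr => w _ /=.
by rewrite !rmorphM !rmorphXn rmorph_nat /= !comp_mpolyXU.
Qed.

Lemma weight_enum_symmetric (N : nat) (C : {vspace 'rV['F_2]_N}) :
  weight_enum C = weight_enum C \mPo [tuple 'X_1; 'X_0]
  <-> const_mx 1 \in C.
Proof.
rewrite weight_enum_swap /weight_enum; split=> [|hC]; last first.
  (* On ['I_N.+1], [rev_ord] is w |-> N - w, so the exponents of the two variables trade places. *)
  rewrite (reindex_inj rev_ord_inj); apply: eq_bigr => w _ /=.
  have lew : (w <= N)%N by rewrite -ltnS.
  by rewrite subSS subKn // weight_countC // [_ * 'X_1 ^+ _]mulrC.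
(* Evaluate at x = 0, y = 1. Since 0 ^ 0 = 1, the left side keeps only its term w = N and the
   swapped side only w = 0, leaving A_N = A_0 over the integers. *)
move/(congr1 (meval (fun i : 'I_2 => (i == 1)%:R))).
rewrite !rmorph_sum /=.
rewrite (bigD1 ord_max) //= [X in _ + X]big1 => [|w hw]; last first.
  rewrite !rmorphM !rmorphXn /= !mevalXU /= expr0n subn_eq0.
  by rewrite leqNgt ltn_neqAle hw -ltnS ltn_ord /= mul0r mulr0.
rewrite (bigD1 ord0) //= [X in _ = _ + X]big1 => [|w hw]; last first.
  rewrite !rmorphM !rmorphXn /= !mevalXU /= expr0n.
  by rewrite (negPf (hw : (w : nat) != 0%N)) !mulr0.
rewrite !rmorphM !rmorphXn !rmorph_nat /= !mevalXU /=.
rewrite subnn subn0 !expr0 !expr1n !mulr1 !addr0.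
by rewrite weight_count0 weight_countN; case: (_ \in _).
Qed.

Lemma mem_gen_mx (N : nat) (C : {vspace 'rV['F_2]_N}) (v : 'rV['F_2]_N) :
  (v \in C) = (v <= gen_mx C)%MS.
Proof. by rewrite -mem_code_of code_of_gen_mx. Qed.

(** If u = D1 G1 and v = D2 G2, the mixed-product rule gives u (x) v = (D1 (x) D2)(G1 (x) G2). *)
Lemma tens_mem_prod_code (N1 N2 : nat)
    (C1 : {vspace 'rV['F_2]_N1}) (C2 : {vspace 'rV['F_2]_N2})
    (u : 'rV['F_2]_N1) (v : 'rV['F_2]_N2) :
  u \in C1 -> v \in C2 -> (u *t v : 'rV_(N1 * N2)) \in prod_code C1 C2.
Proof.
rewrite mem_code_of !mem_gen_mx => /submxP[D1 ->] /submxP[D2 ->].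
by rewrite -tensmx_mul submxMl.
Qed.

Lemma tensmx_const1 (m n p q : nat) :
  (const_mx 1 : 'M['F_2]_(m, n)) *t (const_mx 1 : 'M['F_2]_(p, q)) = const_mx 1.
Proof. by apply/matrixP => i j; rewrite !mxE mulr1. Qed.

(** Multiplying by the all-ones column sums each row, and the rows here are codewords of even
    weight. *)
Lemma gen_SPC_ones (n : nat) :
  gen_mx (SPC n) *m (const_mx 1 : 'cV_n) = 0.
Proof.
apply/row_matrixP => i; rewrite row_mul row0.
have : row i (gen_mx (SPC n)) \in SPC n by rewrite mem_gen_mx row_sub.
rewrite mem_SPC => /eqP h; apply/matrixP => j k; rewrite !mxE ord1 -[RHS]h.
by apply: eq_bigr => l _; rewrite [const_mx _ _ _]mxE mulr1.
Qed.

(** The sum of the entries is the product with the all-ones column of length m n. That column is a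
    tensor of two all-ones columns, so the mixed-product rule reduces the claim to
    [gen_SPC_ones]. *)
Lemma prod_SPC_sum0 (m n : nat) (c : 'rV['F_2]_(m * n)) :
  c \in prod_code (SPC m) (SPC n) -> \sum_i c 0 i = 0.
Proof.
rewrite mem_code_of => /submxP[D ->].
have : D *m (gen_mx (SPC m) *t gen_mx (SPC n)) *m
       ((const_mx 1 : 'cV_m) *t (const_mx 1 : 'cV_n)) = 0.
  by rewrite -mulmxA tensmx_mul !gen_SPC_ones tens0mx mulmx0.
move/matrixP/(_ 0 0); rewrite tensmx_const1 !mxE => h.
by rewrite -[RHS]h; apply: eq_bigr => l _; rewrite [const_mx _ _ _]mxE mulr1.
Qed.

Lemma ones_mem_SPC (n : nat) : (const_mx 1 \in SPC n) = ~~ odd n.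
Proof.
rewrite mem_SPC -natr_F2_eq0 (eq_bigr (fun=> 1)) => [|i _]; last by rewrite mxE.
by rewrite sumr_const card_ord.
Qed.

Lemma ones_mem_prod_SPC (n : nat) :
  (const_mx 1 \in prod_code (SPC n) (SPC n)) = ~~ odd n.
Proof.
apply/idP/idP => [/prod_SPC_sum0|].
  rewrite (eq_bigr (fun=> 1)) => [|i _]; last by rewrite mxE.
  (* The sum is n * n in F_2, and n * n has the parity of n. *)
  by rewrite sumr_const card_ord => /eqP; rewrite natr_F2_eq0 oddM andbb.
rewrite -ones_mem_SPC => h1.
by have := tens_mem_prod_code _ _ _ _ _ _ h1 h1; rewrite tensmx_const1.
Qed.

Theorem corollary2 (n : nat) (hn : (2 <= n)%N) :
  weight_enum (prod_code (SPC n) (SPC n))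
    = weight_enum (prod_code (SPC n) (SPC n)) \mPo [tuple 'X_1; 'X_0]
  <-> ~~ odd n.
Proof. by rewrite -ones_mem_prod_SPC; apply: weight_enum_symmetric. Qed.
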